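(* Let $\delta>0$ and let $p,q\in L^1_{\mathrm{loc}}(\mathbb{R}_+)$ be real-valued. In each of the two following situations, $E_Q(r)=O(e^{-\delta r})$ as $r\to\infty$ holds. (i) $Q=\begin{pmatrix}0&p\\ p&0\end{pmatrix}$ and $\displaystyle\sup_{t\ge r}\left|\int_r^t p(s)\,ds\right|=O\left(e^{-\delta r/2}\right)$ as $r\to\infty$. (ii) $Q=\begin{pmatrix}-q&p\\ p&q\end{pmatrix}$, $\displaystyle\sup_{r\ge0}\int_r^{r+1}\left(|p(s)|+|q(s)|\right)ds<\infty$ and $$\sup_{t\ge r}\left|\int_r^tp(s)\,ds\right|=O\left(e^{-\delta r}\right),\qquad \sup_{t\ge r}\left|\int_r^tq(s)\,ds\right|=O\left(e^{-\delta r}\right),\qquad r\to\infty.$$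
   Context: $\mathbb{R}_+=[0,\infty)$; $f\in L^1_{\mathrm{loc}}(\mathbb{R}_+)$ means $f\in L^1([0,r])$ for every $r>0$. Let $J=\begin{pmatrix}0&-1\\1&0\end{pmatrix}$. For a potential $Q=\begin{pmatrix}-q&p\\ p&q\end{pmatrix}$ with real-valued $p,q\in L^1_{\mathrm{loc}}(\mathbb{R}_+)$ (the case $q=0$ being $Q=\begin{pmatrix}0&p\\ p&0\end{pmatrix}$) let $N_Q$ be the $2\times2$ matrix solution of $JN_Q'(t)+Q(t)N_Q(t)=0$, $N_Q(0)=\begin{pmatrix}1&0\\0&1\end{pmatrix}$, $t\ge0$; put $H_Q(t)=N_Q^*(t)N_Q(t)$ and $E_Q(r)=\det\int_r^{r+2}H_Q(t)\,dt-4$, $r\ge0$. *)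

(* Defs.v *)
From HB Require Import structures.
From mathcomp Require Import all_boot all_order all_algebra.
From mathcomp Require Import all_classical all_reals all_analysis.
Set Implicit Arguments.
Unset Strict Implicit.
Unset Printing Implicit Defensive.
Import Order.TTheory GRing.Theory Num.Theory.
Import numFieldNormedType.Exports.
Local Open Scope classical_set_scope.
Local Open Scope ring_scope.

(* Functions on [0, +oo[ are represented by total functions on R; values at
   negative arguments are irrelevant, since r is nonnegative or tends to +oo. *)

Definition L1loc (R : realType) (f : R -> R) : Prop :=
  forall r : R, 0 < r ->
    (@lebesgue_measure R).-integrable `[0, r]%classic (EFin \o f).

Definition abs_continuous_on (R : realType) (a b : R) (f : R -> R) : Prop :=
  forall e : R, 0 < e -> exists2 d : R, 0 < d &
    forall (n : nat) (u v : 'I_n -> R),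
      (forall i, a <= u i <= v i /\ v i <= b) ->
      trivIset [set: 'I_n] (fun i => `]u i, v i[%classic) ->
      \sum_(i < n) (v i - u i) < d ->
      \sum_(i < n) `|f (v i) - f (u i)| < e.

Definition loc_abs_continuous (R : realType) (f : R -> R) : Prop :=
  forall r : R, 0 < r -> abs_continuous_on 0 r f.

Definition mx22 (R : realType) (a b c d : R) : 'M[R]_2 :=
  \matrix_(i < 2, j < 2)
    if i == ord0 then (if j == ord0 then a else b)
    else (if j == ord0 then c else d).

Definition Jmx (R : realType) : 'M[R]_2 := mx22 0 (-1) 1 0.

Definition Qmx (R : realType) (p q : R -> R) (t : R) : 'M[R]_2 :=
  mx22 (- q t) (p t) (p t) (q t).

(* Since Q is only locally integrable, solutions are understood in the
   Caratheodory sense: entries locally absolutely continuous and the equation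
   satisfied almost everywhere. [derivable] is required explicitly because
   ['D_1 N] is a total operator. *)
Definition is_fundamental_solution (R : realType) (Q N : R -> 'M[R]_2) : Prop :=
  [/\ forall i j, loc_abs_continuous (fun t => N t i j),
      {ae @lebesgue_measure R, forall t : R, 0 < t ->
         derivable N t 1 /\ Jmx R *m 'D_1 N t + Q t *m N t = 0}
    & N 0 = 1%:M].

(* For real Q the solution N is real, so its adjoint is its transpose. *)
Definition Hmx (R : realType) (N : R -> 'M[R]_2) (t : R) : 'M[R]_2 :=
  (N t)^T *m N t.

Definition mx_integral (R : realType) (D : set R) (H : R -> 'M[R]_2) : 'M[R]_2 :=
  \matrix_(i < 2, j < 2) \int[@lebesgue_measure R]_(t in D) H t i j.

Definition EQ (R : realType) (N : R -> 'M[R]_2) (r : R) : R :=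
  \det (mx_integral `[r, r + 2]%classic (Hmx N)) - 4.

(* The supremum is taken in the extended reals, because the real-valued [sup]
   is 0 on unbounded sets. *)
Definition tail_sup (R : realType) (f : R -> R) (r : R) : \bar R :=
  ereal_sup
    [set (`|\int[@lebesgue_measure R]_(s in `[r, t]) f s|)%:E
      | t in [set t : R | r <= t]].

(* The Landau notations require values in a normed module, hence do not apply
   to functions into the extended reals. *)
Definition ereal_bigO_pinfty (R : realType) (f : R -> \bar R) (g : R -> R) : Prop :=
  exists C : R, \forall r \near +oo, (`|f r| <= (C * `|g r|)%:E)%E.

Definition unif_loc_L1 (R : realType) (p q : R -> R) : Prop :=
  (ereal_sup [set \int[@lebesgue_measure R]_(s in `[r, (r + 1)%R])
                    (`|p s| + `|q s|)%:E
               | r in [set r : R | (0 <= r)%R]] < +oo)%E.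

(* Lets the Landau notations be used at +oo. *)
Canonical pinfty_filter_on (R : numFieldType) : filter_on R :=
  FilterType (pinfty_nbhs R) _.

(* Main.v *)
Require Import Defs.
From HB Require Import structures.
From mathcomp Require Import all_boot all_order all_algebra.
From mathcomp Require Import all_classical all_reals all_analysis.
From mathcomp Require Import ring lra.
Set Implicit Arguments.
Unset Strict Implicit.
Unset Printing Implicit Defensive.
Import Order.TTheory GRing.Theory Num.Theory.
Import numFieldNormedType.Exports.
Local Open Scope classical_set_scope.
Local Open Scope ring_scope.

(** The equation [J N' + Q N = 0] reads [N' = A N] with the symmetric traceless
    matrix [A = (-p, -q; -q, p)].  Hence [det N] is constant, equal to 1, and
    replacing [N] by the transition matrix [M t = N t * (N r)^-1] leaves the
    determinant of the integral of [H] over [[r, r + 2]] unchanged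
    ([transition_matrix]).  As [M r = 1], it remains to see how far [M]
    moves away from the identity within time 2.  What makes this small is not
    the size of [p] and [q] but that of their primitives [P t], [Q t] starting
    at [r].

    If [q = 0], then [M t = diag (exp (- P t), exp (P t))] explicitly.  The two
    diagonal integrals are [2 + a] and [2 + b] with [a], [b] of the order of
    [P], but [a + b] is the integral of [exp (2 P) + exp (-2 P) - 2], of the
    order of [P ^ 2]; so [(2 + a) (2 + b) - 4 = 2 (a + b) + a b] is quadratic in
    [P].  This is why half the decay rate is enough
    ([EQ_bound_diagonal]).

    In general, a column [(x, y)] of [M] stays bounded on [[r, r + 2]], since
    [(x ^ 2 + y ^ 2) exp (-2 int (|p| + |q|))] is nonincreasing
    ([system_growth]).  Integrating by parts, [x + P x + Q y] has derivative
    [P x' + Q y'], and [y + Q x - P y] has derivative [Q x' - P y'].  These are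
    at most [eps * const * (|p| + |q|)] when [|P|, |Q| <= eps], so that [M] is
    within [O(eps)] of the identity ([system_oscillation]) and
    [EQ N r = O(eps)] ([EQ_bound_general]).

    All of this is calculus for absolutely continuous functions.  It rests on
    one fact, proved by a covering argument: an absolutely continuous function
    whose derivative is almost everywhere nonpositive is nonincreasing
    ([ac_nonincreasing]).  Together with stability of absolute continuity under
    products and exponentials, it yields every conservation law and every
    estimate above. *)

(** * Monotonicity of absolutely continuous functions *)

(** Continuous induction: the supremum of the points of [[a, b]] satisfying [T]
    belongs to [T] by the first closure property and, by the second one, cannot
    lie before [b]. *)
Lemma real_induction (R : realType) (a b : R) (T : set R) :
  a <= b -> T a ->
  (forall c, a <= c <= b -> exists2 d, 0 < d &
    (forall y, a <= y <= c -> c - d < y -> T y -> T c) /\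
    (forall y, c <= y <= b -> y < c + d -> T c -> T y)) ->
  T b.
Proof.
move=> ab Ta step.
pose E := [set x | a <= x <= b /\ T x].
have Ea : E a by rewrite /E /= lexx ab.
have Eub : ubound E b by move=> x [/andP[]].
have supE : has_sup E by split; [exists a|exists b].
pose c := sup E.
have lec y : E y -> y <= c by apply: ub_le_sup; exists b.
have ac : a <= c by exact: lec.
have cb : c <= b by apply: ge_sup => //; exists a.
have [|d d0 [left right]] := step c; first by rewrite ac cb.
have Tc : T c.
  have [y [/andP[ay yb] Ty] cy] := sup_adherent d0 supE.
  have yc : y <= c by apply: lec; rewrite /E /= ay yb.
  by apply: (left y) => //; rewrite ay yc.
case: (ltP c b) => [ltcb|bc]; last first.
  by have -> : b = c by apply/le_anti; rewrite bc cb.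
pose y := Num.min b (c + d / 2).
have cy : c < y by rewrite lt_min ltcb ltrDl divr_gt0.
have yb : y <= b by rewrite ge_min lexx.
suff /lec : E y by rewrite leNgt cy.
split; first by rewrite yb (le_trans ac (ltW cy)).
apply: right Tc; first by rewrite (ltW cy) yb.
rewrite gt_min; apply/orP; right; rewrite ltrD2l; lra.
Qed.

Lemma derive_le0_near (R : realType) (f : R -> R) (t l e : R) :
  is_derive t 1 f l -> l <= 0 -> 0 < e ->
  \forall y \near t, (y <= t -> f t <= f y + e * (t - y)) /\
                     (t <= y -> f y <= f t + e * (y - t)).
Proof.
move=> [df dfl] l0 e0.
have lte : 'D_1 f t < e by rewrite dfl; apply: le_lt_trans e0.
have := df => /cvgr_lt /(_ _ lte).
rewrite near_withinE => /nbhs_ballP[d /= d0 dP].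
apply/nbhs_ballP; exists d => //= y yt.
have [->|yNt] := eqVneq y t; first by split => _; lra.
have := dP (y - t).
rewrite /ball /= sub0r normrN subr_eq0 => /(_ _ yNt).
rewrite -(normrN (y - t)) opprB => /(_ yt).
rewrite /= /GRing.scale /= mulr1 subrK => h.
split => yt'.
  have yt0 : y - t < 0 by rewrite subr_lt0 lt_neqAle yNt.
  have : (y - t) * ((y - t)^-1 * (f y - f t)) >= (y - t) * e.
    by rewrite ler_nM2l// ltW.
  rewrite mulrA divff ?subr_eq0// mul1r; lra.
have yt0 : 0 < y - t by rewrite subr_gt0 lt_neqAle eq_sym yNt.
have : (y - t) * ((y - t)^-1 * (f y - f t)) <= (y - t) * e.
  by rewrite ler_pM2l// ltW.
rewrite mulrA divff ?subr_eq0// mul1r; lra.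
Qed.

Definition interval_family (R : realType) (a x : R) (U : set R) n
    (u v : 'I_n -> R) :=
  [/\ forall i, a <= u i <= v i /\ v i <= x,
      trivIset [set: 'I_n] (fun i => `]u i, v i[%classic) &
      forall i, `]u i, v i[%classic `<=` U].

(** The growth of [f] between [a] and [x] is split into a part of slope [e] and
    the jumps of [f] over finitely many intervals inside [U].  When [U] has small
    measure, absolute continuity makes the jumps negligible; keeping the family
    explicit avoids the variation of [f] over [U]. *)
Definition jump_reach (R : realType) (f : R -> R) (e a : R) (U : set R)
    (x : R) :=
  exists n (u v : 'I_n -> R), interval_family a x U u v /\
    f x <= f a + e * (x - a) + \sum_(i < n) `|f (v i) - f (u i)|.

Lemma jump_reach_step (R : realType) (f : R -> R) (e a : R) (U : set R)
    (x y : R) :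
  a <= x <= y -> 0 < e -> jump_reach f e a U x ->
  f y <= f x + e * (y - x) \/ `]x, y[%classic `<=` U ->
  jump_reach f e a U y.
Proof.
move=> /andP[ax xy] e0 [n [u [v [[uv tr uvU] fx]]]] [fy|xyU].
  exists n, u, v; split; last first.
    by apply: (le_trans fy); rewrite -lerBrDr; apply: (le_trans fx); lra.
  split=> // i; have [-> /=] := uv i; split=> //; lra.
(* The interval from x to y is appended at the last index. *)
pose u' i := oapp u x (unlift (@ord_max n) i).
pose v' i := oapp v y (unlift (@ord_max n) i).
have u'l (i : 'I_n) : u' (widen_ord (leqnSn n) i) = u i.
  rewrite /u' (_ : widen_ord _ _ = lift ord_max i) ?liftK//.
  by apply/val_inj; rewrite /= /bump leqNgt ltn_ord.
have v'l (i : 'I_n) : v' (widen_ord (leqnSn n) i) = v i.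
  rewrite /v' (_ : widen_ord _ _ = lift ord_max i) ?liftK//.
  by apply/val_inj; rewrite /= /bump leqNgt ltn_ord.
have u'm : u' ord_max = x by rewrite /u' unlift_none.
have v'm : v' ord_max = y by rewrite /v' unlift_none.
exists n.+1, u', v'; split; last first.
  rewrite big_ord_recr /= u'm v'm.
  under eq_bigr do rewrite u'l v'l.
  have := ler_norm (f y - f x); have : e * (x - a) <= e * (y - a).
    by rewrite ler_pM2l// lerD2r.
  move: fx; lra.
split=> [i||i].
- rewrite /u' /v'; case: unliftP => [j _|_] /=; last by rewrite ax xy.
  by have [-> vx] := uv j; split=> //; exact: le_trans vx xy.
- apply/trivIsetP => i j _ _; rewrite /u' /v'.
  case: unliftP => [i' ->|->]; case: unliftP => [j' ->|->] //= ij.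
  + move/trivIsetP : tr; apply => //.
    by apply: contra ij => /eqP ->.
  + apply/seteqP; split=> z //= []; rewrite !in_itv /=.
    move=> /andP[_ h] /andP[h' _].
    have [_ vx] := uv i'; lra.
  + apply/seteqP; split=> z //= []; rewrite !in_itv /=.
    move=> /andP[h' _] /andP[_ h].
    have [_ vx] := uv j'; lra.
  + by rewrite eqxx in ij.
- by rewrite /u' /v'; case: unliftP => [j _|_] /=; [exact: uvU|exact: xyU].
Qed.

Lemma interval_family_length (R : realType) (a x : R) (U : set R) n
    (u v : 'I_n -> R) : measurable U -> interval_family a x U u v ->
  ((\sum_(i < n) (v i - u i))%:E <= @lebesgue_measure R U)%E.
Proof.
move=> mU [uv tr uvU].
have -> : (\sum_(i < n) (v i - u i))%:E =
    (\sum_(i < n) @lebesgue_measure R `]u i, v i[%classic)%E.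
  rewrite -sumEFin; apply: eq_bigr => i _.
  have [/andP[_ uvi] _] := uv i.
  rewrite lebesgue_measure_itv /= lte_fin.
  by move: uvi; rewrite le_eqVlt => /orP[/eqP ->|->//]; rewrite ltxx subrr.
rewrite -(measure_bigsetU_ord _ xpredT)//.
apply: le_measure; rewrite ?inE//; first exact: bigsetU_measurable.
by apply: (big_ind (fun X => X `<=` U)) => // X Y XU YU z [/XU|/YU].
Qed.

(** Fix [e > 0].  The exceptional null set is covered by an open [U] so small that
    the jumps of [f] over disjoint intervals inside [U] add up to less than [e].
    Outside [U] the derivative is at most 0, so [f] locally grows with slope at
    most [e]; inside [U] any growth is counted as a jump.  Continuous induction
    glues these local bounds into [f b <= f a + e * (b - a) + e]. *)
Lemma ac_nonincreasing (R : realType) (a b : R) (f : R -> R) :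
  a <= b -> abs_continuous_on a b f ->
  {ae @lebesgue_measure R, forall t, a < t < b ->
     exists2 l, is_derive t 1 f l & l <= 0} ->
  f b <= f a.
Proof.
move=> ab acf [A [mA A0 badA]].
suff bound e : 0 < e -> f b <= f a + e * (b - a) + e.
  apply/ler_addgt0Pr => e e0.
  have ba1 : 0 < b - a + 1 by rewrite ltr_wpDl// subr_ge0.
  apply: le_trans (bound (e / (b - a + 1)) _) _; first exact: divr_gt0.
  by rewrite -addrA lerD2l -[X in _ + X]mulr1 -mulrDr divfK// gt_eqF.
move=> e0; have [d d0 acd] := acf e e0.
(* The end points are put into the exceptional set, because nothing is known
   about the derivative there. *)
pose B := A `|` [set a; b].
have mB : measurable B by apply: measurableU => //; apply: measurableU.
have B0 : @lebesgue_measure R B = 0%E.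
  apply/eqP; rewrite -measure_le0; apply: (le_trans (measureU2 _ _ _)) => //.
    exact: measurableU.
  rewrite [X in (X + _)%E]A0 add0e; apply: (le_trans (measureU2 _ _ _)) => //.
  rewrite [X in (X + _)%E]lebesgue_measure_set1 add0e.
  by rewrite [X in (X <= _)%E]lebesgue_measure_set1.
have [|U [oU BU muU]] := lebesgue_regularity_outer mB _ d0.
  by rewrite [X in (X < _)%E]B0.
have mU : measurable U by exact: measurable_realfun.open_measurable.
have {muU} Ud : (@lebesgue_measure R U < d%:E)%E.
  rewrite (le_lt_trans _ muU)// -[X in (_ X <= _)%E](setDUK BU).
  apply: (le_trans (measureU2 _ _ _)) => //; first exact: measurableD.
  by rewrite [X in (X + _)%E]B0 add0e.
have [n [u [v [fam fb]]]] : jump_reach f e a U b.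
  apply: (real_induction (a := a)) => //.
    exists 0, (fun=> a), (fun=> a); split.
      by split=> [[]//||[]//]; apply/trivIsetP => -[].
    by rewrite big_ord0 subrr mulr0 !addr0.
  move=> c /andP[ac cb]; have [Uc|Uc] := pselect (U c).
    have /nbhs_ballP[r /= r0 rU] := oU _ Uc.
    exists r => //; split=> y /andP[h1 h2] h3; last first.
      move=> /jump_reach_step; apply; rewrite ?ac//; right => z /=.
      rewrite in_itv /= => /andP[h4 h5]; apply: rU.
      by rewrite /ball /= distrC ger0_norm; lra.
    move=> /jump_reach_step; apply; rewrite ?h1//; right => z /=.
    rewrite in_itv /= => /andP[h4 h5]; apply: rU.
    by rewrite /ball /= ger0_norm; lra.
  have ca : a != c by apply: contra_not_neq Uc => <-; apply: BU; right; left.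
  have cb' : c != b by apply: contra_not_neq Uc => ->; apply: BU; right; right.
  have ltac : a < c by rewrite lt_neqAle ca.
  have ltcb : c < b by rewrite lt_neqAle cb'.
  have [l fl l0] : exists2 l, is_derive c 1 f l & l <= 0.
    apply: contrapT => h; apply: Uc; apply: BU; left; apply: badA => /=.
    by apply/not_implyP; rewrite ltac ltcb.
  have /nbhs_ballP[r /= r0 rU] := derive_le0_near fl l0 e0.
  exists r => //; split=> y /andP[h1 h2] h3 /jump_reach_step; apply => //.
  - by rewrite h1.
  - by left; apply: (rU y _).1 => //; rewrite /ball /= ger0_norm; lra.
  - by rewrite ac.
  - by left; apply: (rU y _).2 => //; rewrite /ball /= distrC ger0_norm; lra.
apply: (le_trans fb); rewrite lerD2l ltW//.
case: (fam) => uv tr _; apply: acd => //.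
by rewrite -lte_fin (le_lt_trans _ Ud)//; exact: interval_family_length fam.
Qed.

(** * Calculus of absolutely continuous functions *)

(** A single criterion covering sums, products and exponentials. *)
Lemma ac_dominated (R : realType) (a b C : R) (f g h : R -> R) :
  abs_continuous_on a b f -> abs_continuous_on a b g ->
  (forall u v, a <= u <= v -> v <= b ->
     `|h v - h u| <= C * (`|f v - f u| + `|g v - g u|)) ->
  abs_continuous_on a b h.
Proof.
move=> acf acg hfg e e0; pose K := 2 * (`|C| + 1).
have K0 : 0 < K by rewrite mulr_gt0// ltr_wpDl.
have [d1 d10 F] := acf (e / K) (divr_gt0 e0 K0).
have [d2 d20 G] := acg (e / K) (divr_gt0 e0 K0).
exists (Num.min d1 d2); first by rewrite lt_min d10.
move=> n u v uv tr; rewrite lt_min => /andP[].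
move=> /(F n u v uv tr) Fs /(G n u v uv tr) Gs.
set sf := \sum_(i < n) _ in Fs; set sg := \sum_(i < n) _ in Gs.
have sf0 : 0 <= sf by exact: sumr_ge0.
have sg0 : 0 <= sg by exact: sumr_ge0.
apply: (@le_lt_trans _ _ (`|C| * (sf + sg))).
  rewrite /sf /sg -big_split /= mulr_sumr; apply: ler_sum => i _.
  have [uvi vb] := uv i; apply: (le_trans (hfg _ _ uvi vb)).
  by rewrite ler_wpM2r ?addr_ge0// ler_norm.
have -> : e = (e / K + e / K) * (`|C| + 1).
  by rewrite -mulr2n -mulr_natl /K; field; rewrite gt_eqF// ltr_wpDl.
apply: (@le_lt_trans _ _ ((`|C| + 1) * (sf + sg))).
  by rewrite ler_wpM2r ?addr_ge0 ?lerDl.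
rewrite mulrC ltr_pM2r; first exact: ltrD.
by rewrite ltr_wpDl.
Qed.

Lemma ac_continuous (R : realType) (a b : R) (f : R -> R) :
  abs_continuous_on a b f -> {within `[a, b], continuous f}.
Proof.
move=> acf; apply/subspace_continuousP => x.
rewrite /= in_itv /= => /andP[ax xb].
apply/cvgrPdist_lt => e e0; have [d d0 H] := acf e e0.
have {}H u v : a <= u <= v -> v <= b -> v - u < d -> `|f v - f u| < e.
  move=> uv vb vud; have := H 1 (fun=> u) (fun=> v); rewrite !big_ord1.
  by apply => //; apply/trivIsetP => i j _ _; rewrite !ord1 eqxx.
rewrite near_withinE; apply/nbhs_ballP; exists d => //= y.
rewrite /ball /= => xy; rewrite in_itv /= => /andP[ay yb].
case: (leP x y) => [lexy|/ltW leyx].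
  rewrite distrC; apply: H; rewrite ?ax//.
  by move: xy; rewrite distrC ger0_norm// subr_ge0.
by apply: H; rewrite ?ay//; move: xy; rewrite ger0_norm// subr_ge0.
Qed.

Lemma ac_bounded (R : realType) (a b : R) (f : R -> R) :
  abs_continuous_on a b f ->
  exists2 M, 0 <= M & forall x, a <= x <= b -> `|f x| <= M.
Proof.
move=> /ac_continuous cf.
have /compact_bounded := continuous_compact cf (@segment_compact _ a b).
move=> [M [_ MP]]; exists (`|M| + 1); first by rewrite addr_ge0.
move=> x xab; apply: (MP (`|M| + 1)).
  by rewrite (le_lt_trans (ler_norm M))// ltrDl.
by exists x => //=; rewrite in_itv.
Qed.

Lemma ac_subinterval (R : realType) (a b c d : R) (f : R -> R) :
  a <= c -> d <= b -> abs_continuous_on a b f -> abs_continuous_on c d f.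
Proof.
move=> ac db acf e /acf [x x0 H]; exists x => // n u v uv; apply: H => i.
have [/andP[h1 h2] h3] := uv i; lra.
Qed.

Instance lebesgue_ae_filter (R : realType) :
  Filter (nbhs (almost_everywhere (@lebesgue_measure R))) :=
  ae_filter_ringOfSetsType _.

(** [f] is a primitive of [g] in the sense of Caratheodory.  Pairing [f] with an
    everywhere defined [g] turns differential inequalities into pointwise
    statements without exceptional sets. *)
Definition ac_primitive (R : realType) (a b : R) (f g : R -> R) :=
  abs_continuous_on a b f /\
  {ae @lebesgue_measure R, forall t, a < t < b -> is_derive t 1 f (g t)}.

Lemma expR_lipschitz (R : realType) (A x y : R) :
  x <= A -> y <= A -> `|expR x - expR y| <= expR A * `|x - y|.
Proof.
wlog yx : x y / y <= x => [H xA yA|xA _].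
  by case: (leP y x) => [|/ltW] h; [|rewrite distrC (distrC x)]; exact: H.
rewrite !ger0_norm ?subr_ge0 ?ler_expR//.
have -> : expR x - expR y = expR x * (1 - expR (y - x)).
  by rewrite mulrBr mulr1 -expRD addrCA subrr addr0.
apply: (@le_trans _ _ (expR x * (x - y))).
  by rewrite ler_wpM2l ?expR_ge0//; have := expR_ge1Dx (y - x); lra.
by rewrite ler_wpM2r ?subr_ge0// ler_expR.
Qed.

Section ac_primitive.
Variables (R : realType) (a b : R).
Local Notation mu := (@lebesgue_measure R).
Implicit Types f g df dg : R -> R.

Lemma ac_primitive_subinterval c d f df : a <= c -> d <= b ->
  ac_primitive a b f df -> ac_primitive c d f df.
Proof.
move=> ac db [acf fdf]; split; first exact: ac_subinterval acf.
move: fdf; apply: filterS => t H /andP[h1 h2]; apply: H; lra.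
Qed.

Lemma eq_ac_primitive f df df' : (forall t, a < t < b -> df t = df' t) ->
  ac_primitive a b f df -> ac_primitive a b f df'.
Proof.
move=> e [acf fdf]; split=> //.
by move: fdf; apply: filterS => t H tab; rewrite -e//; exact: H.
Qed.

Lemma ac_primitive_cst (k : R) : ac_primitive a b (fun=> k) (fun=> 0).
Proof.
split; last by apply: aeW => t _; exact: is_derive_cst.
move=> e e0; exists 1 => // n u v _ _ _.
by rewrite big1// => i _; rewrite subrr normr0.
Qed.

Lemma ac_primitiveD f g df dg :
  ac_primitive a b f df -> ac_primitive a b g dg ->
  ac_primitive a b (fun t => f t + g t) (fun t => df t + dg t).
Proof.
move=> [acf fdf] [acg gdg]; split.
  apply: (ac_dominated (C := 1) acf acg) => u v _ _.
  by rewrite mul1r (le_trans _ (ler_normD _ _))// opprD addrACA.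
move: fdf gdg; apply: filterS2 => t F G tab.
by have := is_deriveD (F tab) (G tab).
Qed.

Lemma ac_primitiveM f g df dg :
  ac_primitive a b f df -> ac_primitive a b g dg ->
  ac_primitive a b (fun t => f t * g t) (fun t => df t * g t + f t * dg t).
Proof.
move=> [acf fdf] [acg gdg]; split.
  have [A A0 fA] := ac_bounded acf; have [B B0 gB] := ac_bounded acg.
  apply: (ac_dominated (C := A + B) acf acg) => u v /andP[au uv] vb.
  have -> : f v * g v - f u * g u = (f v - f u) * g v + f u * (g v - g u).
    by ring.
  have gv : `|g v| <= B by apply: gB; rewrite vb (le_trans au).
  have fu : `|f u| <= A by apply: fA; rewrite au (le_trans uv).
  rewrite (le_trans (ler_normD _ _))// !normrM.
  have := ler_wpM2l (normr_ge0 (f v - f u)) gv.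
  have := ler_wpM2r (normr_ge0 (g v - g u)) fu.
  have := mulr_ge0 A0 (normr_ge0 (f v - f u)).
  have := mulr_ge0 B0 (normr_ge0 (g v - g u)).
  lra.
move: fdf gdg; apply: filterS2 => t F G tab.
have := is_deriveM (F tab) (G tab).
by rewrite /GRing.scale /= addrC [g t * _]mulrC.
Qed.

Lemma ac_primitiveZ (k : R) f df : ac_primitive a b f df ->
  ac_primitive a b (fun t => k * f t) (fun t => k * df t).
Proof.
move=> /(ac_primitiveM (ac_primitive_cst k)); apply: eq_ac_primitive => t _.
by rewrite mul0r add0r.
Qed.

Lemma ac_primitive_expR f df : ac_primitive a b f df ->
  ac_primitive a b (fun t => expR (f t)) (fun t => df t * expR (f t)).
Proof.
move=> [acf fdf]; split.
  have [A A0 fA] := ac_bounded acf.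
  apply: (ac_dominated (C := expR A) acf acf) => u v /andP[au uv] vb.
  have fv : f v <= A by rewrite (le_trans (ler_norm _))// fA// vb (le_trans au).
  have fu : f u <= A by rewrite (le_trans (ler_norm _))// fA// au (le_trans uv).
  apply: le_trans (expR_lipschitz fv fu) _.
  by rewrite ler_wpM2l ?expR_ge0 ?lerDl.
move: fdf; apply: filterS => t F tab.
have := is_derive1_comp (is_derive_expR (f t)) (F tab).
by rewrite mulrC.
Qed.

End ac_primitive.

Section ac_primitive_estimates.
Variables (R : realType) (a b : R).
Local Notation mu := (@lebesgue_measure R).
Hypothesis ab : a <= b.
Implicit Types f g df dg : R -> R.

Lemma ac_primitive_nonincreasing f df : ac_primitive a b f df ->
  (forall t, a < t < b -> df t <= 0) -> f b <= f a.
Proof.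
move=> [acf fdf] df0; apply: ac_nonincreasing => //.
by move: fdf; apply: filterS => t F tab; exists (df t); [exact: F|exact: df0].
Qed.

Lemma ac_primitive_dist_le f g df dg :
  ac_primitive a b f df -> ac_primitive a b g dg ->
  (forall t, a < t < b -> `|df t| <= dg t) -> `|f b - f a| <= g b - g a.
Proof.
move=> F G fg; rewrite ler_norml; apply/andP; split.
  have := ac_primitive_nonincreasing
    (ac_primitiveD (ac_primitiveZ (-1) F) (ac_primitiveZ (-1) G)).
  rewrite /= !mulN1r => H.
  suff : - f b - g b <= - f a - g a by lra.
  by apply: H => t /fg; rewrite ler_norml => /andP[? ?]; lra.
have := ac_primitive_nonincreasing (ac_primitiveD F (ac_primitiveZ (-1) G)).
rewrite /= !mulN1r => H.
suff : f b - g b <= f a - g a by lra.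
by apply: H => t /fg; rewrite ler_norml => /andP[? ?]; lra.
Qed.

Lemma ac_primitive_constant f df : ac_primitive a b f df ->
  (forall t, a < t < b -> df t = 0) -> f b = f a.
Proof.
move=> F df0; apply/eqP; rewrite -subr_eq0 -normr_le0.
have := ac_primitive_dist_le F (ac_primitive_cst a b 0); rewrite subrr; apply.
by move=> t /df0 ->; rewrite normr0.
Qed.

End ac_primitive_estimates.

(** * Integration *)

Lemma Rintegral_bigsetU d (T : measurableType d) (R : realType)
    (mu : measure T R) n (A : 'I_n -> set T) (g : T -> R) :
  (forall i, measurable (A i)) -> trivIset [set: 'I_n] A ->
  mu.-integrable [set: T] (EFin \o g) ->
  \int[mu]_(x in \big[setU/set0]_(i < n) A i) g x =
  \sum_(i < n) \int[mu]_(x in A i) g x.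
Proof.
move=> mA tA ig; rewrite /Rintegral integral_bigsetU_EFin//.
- rewrite -sum_fine// => i _; apply: integrable_fin_num => //.
  exact: integrableS ig.
- exact: index_enum_uniq.
- exact: sub_trivIset tA.
- by apply: measurable_funS (measurable_int _ ig).
Qed.

Lemma integrable_extend0 (R : realType) (a b : R) (p : R -> R) :
  (@lebesgue_measure R).-integrable `[a, b] (EFin \o p) ->
  (@lebesgue_measure R).-integrable setT (EFin \o (p \_ `[a, b] : R -> R)).
Proof.
have mI : measurable (`[a, b]%classic : set (measurableTypeR R)).
  exact: measurable_itv.
move=> /(integrable_mkcond (mu := @lebesgue_measure R) (EFin \o p) mI).1.
by rewrite restrict_EFin.
Qed.

Lemma integrable_initial (R : realType) (a b t : R) (p : R -> R) : t <= b ->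
  (@lebesgue_measure R).-integrable `[a, b] (EFin \o p) ->
  (@lebesgue_measure R).-integrable `[a, t] (EFin \o p).
Proof.
move=> tb; apply: integrableS; [exact: measurable_itv|exact: measurable_itv|].
by move=> s /=; rewrite !in_itv /= => /andP[-> st]; exact: le_trans tb.
Qed.

Lemma Rintegral_initial_le (R : realType) (a b t : R) (h : R -> R) :
  a <= t <= b -> (forall s, 0 <= h s) ->
  (@lebesgue_measure R).-integrable `[a, b] (EFin \o h) ->
  \int[@lebesgue_measure R]_(s in `[a, t]) h s <=
  \int[@lebesgue_measure R]_(s in `[a, b]) h s.
Proof.
move=> /andP[at_ tb] h0 ih; rewrite -subr_ge0 Rintegral_itvB ?bnd_simp//.
by apply: Rintegral_ge0 => s _.
Qed.

Lemma ac_integral (R : realType) (a b : R) (p : R -> R) :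
  (@lebesgue_measure R).-integrable `[a, b] (EFin \o p) ->
  abs_continuous_on a b (fun t => \int[@lebesgue_measure R]_(s in `[a, t]) p s).
Proof.
move=> ip; pose g : R -> R := p \_ `[a, b].
have ig : (@lebesgue_measure R).-integrable setT (EFin \o g).
  exact: integrable_extend0.
move=> e e0; have [d [d0 H]] := integral_normr_continuous ig e0.
exists d => // n u v uv tr uvd.
pose A i : set (measurableTypeR R) := `]u i, v i[%classic.
have mA i : measurable (A i) by exact: measurable_itv.
apply: (@le_lt_trans _ _
    (\sum_(i < n) \int[@lebesgue_measure R]_(x in A i) `|g x|)).
  apply: ler_sum => i _; have [/andP[aui uvi] vb] := uv i.
  have iS (I : interval R) : [set` I] `<=` `[a, b] ->
      (@lebesgue_measure R).-integrable [set` I] (EFin \o p).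
    by move=> Ib; apply: integrableS ip.
  rewrite Rintegral_itvB//; first last.
  - by apply: iS => x /=; rewrite !in_itv /= => /andP[h1 h2]; lra.
  have Aab : A i `<=` `[a, b].
    move=> x /=; rewrite /A /= !in_itv /= => /andP[h1 h2].
    by rewrite (le_trans aui (ltW h1)) (le_trans (ltW h2) vb).
  rewrite -Rintegral_itv_bndo_bndc; last exact: iS.
  apply: (le_trans (le_normr_Rintegral _ _)) => //; first exact: iS.
  rewrite le_eqVlt; apply/orP; left; apply/eqP; apply: eq_Rintegral => x.
  by rewrite inE => /Aab xab; rewrite /g patchE mem_set.
rewrite -Rintegral_bigsetU//; last exact: integrable_norm.
apply: H; first exact: bigsetU_measurable.
rewrite measure_bigsetU_ord//.
rewrite (le_lt_trans _ (_ : ((\sum_(i < n) (v i - u i))%:E < d%:E)%E))//.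
rewrite -sumEFin; apply: lee_sum => i _.
rewrite [X in (X <= _)%E]lebesgue_measure_itv /= lte_fin; case: ifP => // _.
by rewrite lee_fin subr_ge0; have [/andP[]] := uv i.
Qed.

(** Almost every point is a Lebesgue point of [p]; extending [p] by 0 outside
    [[a, b]] gives a globally integrable function without changing the integrals
    near a point of the open interval. *)
Lemma ac_primitive_integral (R : realType) (a b : R) (p : R -> R) :
  (@lebesgue_measure R).-integrable `[a, b] (EFin \o p) ->
  ac_primitive a b (fun t => \int[@lebesgue_measure R]_(s in `[a, t]) p s) p.
Proof.
move=> ip; split; first exact: ac_integral.
pose g : R -> R := p \_ `[a, b].
have ig : (@lebesgue_measure R).-integrable setT (EFin \o g).
  exact: integrable_extend0.
have /FTC1 : forall y, (@lebesgue_measure R).-integrable `[a, y] (EFin \o g).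
  by move=> y; apply: integrableS ig.
move=> /(_ (integrable_locally _ ip)) H.
have {}H := H (measurable_itv _).
move: H; apply: filterS => t H /andP[ta tb].
have [|dF] := H; first by rewrite lte_fin.
rewrite derive1E => Ft.
have gp x : x <= b -> \int[@lebesgue_measure R]_(s in `[a, x]) g s =
    \int[@lebesgue_measure R]_(s in `[a, x]) p s.
  move=> xb; apply: eq_Rintegral => s; rewrite inE /= in_itv /= => /andP[h1 h2].
  by rewrite /g patchE mem_set//= in_itv /= h1 (le_trans h2).
have -> : p t = g t by rewrite /g patchE mem_set//= in_itv /= !ltW.
apply: (near_eq_is_derive
  (f := fun x => \int[@lebesgue_measure R]_(s in `[a, x]) g s)).
  by near=> x; apply: gp; apply: ltW; near: x; exact: lt_nbhsl.
by split.
Unshelve. all: by end_near.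
Qed.

Lemma Rintegral_lincomb d (T : measurableType d) (R : realType)
    (mu : measure T R) (D : set T) (k l : R) (f g : T -> R) : measurable D ->
  mu.-integrable D (EFin \o f) -> mu.-integrable D (EFin \o g) ->
  mu.-integrable D (EFin \o (fun t => k * f t + l * g t)) /\
  \int[mu]_(t in D) (k * f t + l * g t) =
    k * \int[mu]_(t in D) f t + l * \int[mu]_(t in D) g t.
Proof.
move=> mD fi gi.
have kf : mu.-integrable D (EFin \o (fun t => k * f t)) := integrableZl mD k fi.
have lg : mu.-integrable D (EFin \o (fun t => l * g t)) := integrableZl mD l gi.
split; first exact: (integrableD mD kf lg).
by rewrite RintegralD// !RintegralZl.
Qed.

Section interval_integrals.
Variable R : realType.
Local Notation mu := (@lebesgue_measure R).
Implicit Types (a b r : R) (f g p q : R -> R).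

Lemma ac_primitive_integrable a b f df :
  ac_primitive a b f df -> mu.-integrable `[a, b] (EFin \o f).
Proof.
move=> [/ac_continuous cf _].
exact: continuous_compact_integrable (@segment_compact _ _ _) cf.
Qed.

Lemma integrable_normD a b p q : mu.-integrable `[a, b] (EFin \o p) ->
  mu.-integrable `[a, b] (EFin \o q) ->
  mu.-integrable `[a, b] (EFin \o (fun s => `|p s| + `|q s|)).
Proof.
move=> /integrable_norm ip /integrable_norm iq.
by have := integrableD _ ip iq; apply; exact: measurable_itv.
Qed.

Lemma Rintegral_itv_lincomb a b (k l : R) f g :
  mu.-integrable `[a, b] (EFin \o f) -> mu.-integrable `[a, b] (EFin \o g) ->
  mu.-integrable `[a, b] (EFin \o (fun t => k * f t + l * g t)) /\
  \int[mu]_(t in `[a, b]) (k * f t + l * g t) =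
    k * \int[mu]_(t in `[a, b]) f t + l * \int[mu]_(t in `[a, b]) g t.
Proof.
by move=> fi gi; apply: Rintegral_lincomb => //; exact: measurable_itv.
Qed.

Lemma Rintegral_itv2_near r f (c z : R) :
  mu.-integrable `[r, r + 2] (EFin \o f) ->
  (forall t, r <= t <= r + 2 -> `|f t - c| <= z) ->
  `|\int[mu]_(t in `[r, r + 2]) f t - 2 * c| <= 2 * z.
Proof.
move=> fi fc.
have cst k : mu.-integrable `[r, r + 2] (EFin \o cst k) /\
    \int[mu]_(t in `[r, r + 2]) k = 2 * k.
  split; first exact: (ac_primitive_integrable (ac_primitive_cst _ _ k)).
  rewrite Rintegral_cst//= lebesgue_measure_itv /= lte_fin ltrDl ltr0n /=.
  by rewrite mulrC; congr (_ * _); ring.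
have lo : 2 * (c - z) <= \int[mu]_(t in `[r, r + 2]) f t.
  rewrite -(cst _).2; apply: le_Rintegral => //; first exact: (cst _).1.
  by move=> t /=; rewrite in_itv /= => /fc; rewrite ler_norml => /andP[? ?]; lra.
have hi : \int[mu]_(t in `[r, r + 2]) f t <= 2 * (c + z).
  rewrite -(cst _).2; apply: le_Rintegral => //; first exact: (cst _).1.
  by move=> t /=; rewrite in_itv /= => /fc; rewrite ler_norml => /andP[? ?]; lra.
move: lo hi; set I := Rintegral _ _ _; move: I => I lo hi.
by rewrite ler_norml; lra.
Qed.

End interval_integrals.

(** * Two by two matrices *)

Lemma lift0_max : @lift 2 ord0 ord0 = ord_max.
Proof. exact/val_inj. Qed.

Lemma ord2P (P : 'I_2 -> Prop) : P ord0 -> P ord_max -> forall i, P i.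
Proof.
move=> P0 P1 i; case: (unliftP ord0 i) => [j ->|->//].
by rewrite (ord1 j) lift0_max.
Qed.

Lemma det_mx22 (R : comPzRingType) (A : 'M[R]_2) :
  \det A = A ord0 ord0 * A ord_max ord_max - A ord0 ord_max * A ord_max ord0.
Proof.
rewrite (expand_det_row _ ord0) !big_ord_recl big_ord0 addr0 /cofactor.
rewrite !det_mx11 !mxE /=.
have e2 : @lift 2 ord_max ord0 = ord0 by exact/val_inj.
by rewrite lift0_max e2 /= !expr0 expr1 mul1r mulN1r mulrN.
Qed.

Lemma HmxE (R : realType) (M : R -> 'M[R]_2) (t : R) i j :
  Hmx M t i j = M t ord0 i * M t ord0 j + M t ord_max i * M t ord_max j.
Proof. by rewrite /Hmx mxE !big_ord_recl big_ord0 lift0_max addr0 !mxE. Qed.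

Lemma mx_integral_congruence (R : realType) (a b : R) (X : R -> 'M[R]_2)
    (B : 'M[R]_2) :
  (forall i j, (@lebesgue_measure R).-integrable `[a, b]
     (EFin \o (fun t => X t i j))) ->
  mx_integral `[a, b] (fun t => B^T *m X t *m B) =
  B^T *m mx_integral `[a, b] X *m B.
Proof.
move=> iX; apply/matrixP => i j.
have iBX k := Rintegral_itv_lincomb (B ord0 i) (B ord_max i)
  (iX ord0 k) (iX ord_max k).
rewrite !mxE !big_ord_recl big_ord0 !mxE lift0_max.
transitivity (\int[@lebesgue_measure R]_(t in `[a, b])
  (B ord0 j * (B ord0 i * X t ord0 ord0 + B ord_max i * X t ord_max ord0) +
   B ord_max j *
     (B ord0 i * X t ord0 ord_max + B ord_max i * X t ord_max ord_max))).
  apply: eq_Rintegral => t _.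
  rewrite !mxE !big_ord_recl big_ord0 !mxE lift0_max.
  by rewrite !big_ord_recl !big_ord0 !mxE lift0_max !addr0; ring.
have [i0 e0] := iBX ord0; have [i1 e1] := iBX ord_max.
rewrite (Rintegral_itv_lincomb _ _ i0 i1).2 e0 e1.
rewrite !big_ord_recl !big_ord0 !mxE lift0_max; ring.
Qed.

Lemma prod_near_le (R : realFieldType) (a b a' b' z : R) :
  `|a - a'| <= z -> `|b - b'| <= z ->
  `|a * b - a' * b'| <= (`|a'| + `|b'|) * z + z ^+ 2.
Proof.
move=> az bz.
have -> : a * b - a' * b' =
  (a - a') * b' + a' * (b - b') + (a - a') * (b - b') by ring.
rewrite (le_trans (ler_normD _ _))// lerD//; last first.
  by rewrite normrM expr2 ler_pM.
rewrite (le_trans (ler_normD _ _))// !normrM mulrDl addrC lerD//.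
  by rewrite ler_wpM2l.
by rewrite mulrC ler_wpM2l.
Qed.

Lemma det_near_scalar2 (R : realFieldType) (G : 'M[R]_2) (z : R) :
  (forall i j, `|G i j - 2 * (i == j)%:R| <= z) ->
  `|\det G - 4| <= 4 * z + 2 * z ^+ 2.
Proof.
move=> Gz; rewrite det_mx22.
have := prod_near_le (Gz ord0 ord0) (Gz ord_max ord_max).
have := prod_near_le (Gz ord0 ord_max) (Gz ord_max ord0).
rewrite /= !mulr0 !mulr1 !subr0 !normr0 addr0 mul0r add0r.
rewrite (ger0_norm (ler0n _ _)) => h1 h2.
have -> : G ord0 ord0 * G ord_max ord_max - G ord0 ord_max * G ord_max ord0 - 4 =
  G ord0 ord0 * G ord_max ord_max - 2 * 2 - G ord0 ord_max * G ord_max ord0.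
  by ring.
rewrite (le_trans (ler_normB _ _))//; lra.
Qed.

Lemma Hmx_near_1 (R : realType) (M : R -> 'M[R]_2) (t z : R) :
  (forall i j, `|M t i j - (i == j)%:R| <= z) ->
  forall i j, `|Hmx M t i j - (i == j)%:R| <= 2 * z + 2 * z ^+ 2.
Proof.
move=> Mz i j; rewrite HmxE.
have h0 := prod_near_le (Mz ord0 i) (Mz ord0 j).
have h1 := prod_near_le (Mz ord_max i) (Mz ord_max j).
have -> : (i == j)%:R = (ord0 == i)%:R * (ord0 == j)%:R +
    (ord_max == i)%:R * (ord_max == j)%:R :> R.
  move: i j {h0 h1}; do 2 apply: ord2P;
  by rewrite /= ?mulr1 ?mulr0 ?addr0 ?add0r.
rewrite opprD addrACA (le_trans (ler_normD _ _))//.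
rewrite !normr_nat in h0 h1.
have e : (ord0 == i)%:R + (ord_max == i)%:R = 1 :> R.
  by move: i {h0 h1}; apply: ord2P; rewrite /= ?addr0 ?add0r.
have e' : (ord0 == j)%:R + (ord_max == j)%:R = 1 :> R.
  by move: j {h0 h1}; apply: ord2P; rewrite /= ?addr0 ?add0r.
have -> : 2 * z + 2 * z ^+ 2 =
  (((ord0 == i)%:R + (ord0 == j)%:R) * z + z ^+ 2) +
  (((ord_max == i)%:R + (ord_max == j)%:R) * z + z ^+ 2).
  transitivity ((((ord0 == i)%:R + (ord_max == i)%:R) +
      ((ord0 == j)%:R + (ord_max == j)%:R)) * z + 2 * z ^+ 2).
    by rewrite e e'; ring.
  by ring.
exact: lerD.
Qed.

(** * The differential system *)

(** The two rows of [N' = A N], applied to one column [(x, y)] of [N]. *)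
Definition system_solution (R : realType) (p q : R -> R) (a b : R)
    (x y : R -> R) :=
  ac_primitive a b x (fun t => - (p t * x t) - q t * y t) /\
  ac_primitive a b y (fun t => p t * y t - q t * x t).

(** The increment [d] of a component is recovered from the increment of the
    corrected component, which is [d + (u * w + v * z)]; here [u], [v] are values
    of primitives of [p], [q] up to sign. *)
Lemma perturbed_increment_le (R : realFieldType) (eps B A K u v w z d : R) :
  0 <= eps -> 0 <= B -> A <= K ->
  `|u| <= eps -> `|v| <= eps -> `|w| <= B -> `|z| <= B ->
  `|d + (u * w + v * z)| <= 2 * B * eps * A ->
  `|d| <= eps * (2 * B * (1 + K)).
Proof.
move=> eps0 B0 AK ue ve wB zB dle.
have h1 : `|u * w| <= eps * B by rewrite normrM ler_pM.
have h2 : `|v * z| <= eps * B by rewrite normrM ler_pM.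
have h3 : 2 * B * eps * A <= 2 * B * eps * K by rewrite ler_wpM2l// !mulr_ge0.
have -> : d = (d + (u * w + v * z)) - (u * w + v * z) by ring.
rewrite (le_trans (ler_normB _ _))//.
have h4 := ler_normD (u * w) (v * z); lra.
Qed.

Section system.
Variables (R : realType) (p q : R -> R).
Local Notation mu := (@lebesgue_measure R).
Implicit Types a b : R.

Lemma system_solution_subinterval a b c d x y : a <= c -> d <= b ->
  system_solution p q a b x y -> system_solution p q c d x y.
Proof.
move=> ac db [X Y]; split; first exact: ac_primitive_subinterval X.
exact: ac_primitive_subinterval Y.
Qed.

Lemma system_solution_linear a b k l x y x' y' :
  system_solution p q a b x y -> system_solution p q a b x' y' ->
  system_solution p q a b
    (fun t => k * x t + l * x' t) (fun t => k * y t + l * y' t).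
Proof.
move=> [X Y] [X' Y']; split.
  have := ac_primitiveD (ac_primitiveZ k X) (ac_primitiveZ l X').
  by apply: eq_ac_primitive => t _; ring.
have := ac_primitiveD (ac_primitiveZ k Y) (ac_primitiveZ l Y').
by apply: eq_ac_primitive => t _; ring.
Qed.

(** Liouville's formula: the coefficient matrix has trace 0. *)
Lemma system_wronskian a b x y x' y' : a <= b ->
  system_solution p q a b x y -> system_solution p q a b x' y' ->
  x b * y' b - x' b * y b = x a * y' a - x' a * y a.
Proof.
move=> ab [X Y] [X' Y'].
have := ac_primitiveD (ac_primitiveM X Y')
  (ac_primitiveZ (-1) (ac_primitiveM X' Y)).
move=> /(ac_primitive_constant ab); rewrite /= !mulN1r; apply.
by move=> t _; ring.
Qed.

Lemma fundamental_solution_columns N b j : 0 < b ->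
  is_fundamental_solution (Qmx p q) N ->
  system_solution p q 0 b (fun t => N t ord0 j) (fun t => N t ord_max j).
Proof.
move=> b0 [acN eqN _].
have key i v : (forall t, derivable N t 1 ->
      Jmx R *m 'D_1 N t + Qmx p q t *m N t = 0 -> 'D_1 N t i j = v t) ->
    ac_primitive 0 b (fun t => N t i j) v.
  move=> H; split; first exact: acN.
  move: eqN; apply: filterS => t /[swap] /andP[t0 tb] /(_ t0) [dN NE].
  split; first exact: (derivable_mxP N t 1).1 dN i j.
  by rewrite -(H t dN NE) derive_mx// mxE.
(* J swaps the rows, so each component is read off the other row. *)
split; apply: key => t _ /matrixP NE.
  have := NE ord_max j.
  rewrite !mxE !big_ord_recl !big_ord0 !mxE /= lift0_max; lra.
have := NE ord0 j; rewrite !mxE !big_ord_recl !big_ord0 !mxE /= lift0_max; lra.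
Qed.

Lemma fundamental_solution_det N r : 0 <= r ->
  is_fundamental_solution (Qmx p q) N -> \det (N r) = 1.
Proof.
rewrite le_eqVlt => /predU1P[<- [_ _ ->]|r0 solN]; first exact: det1.
have [_ _ N0] := solN.
have := system_wronskian (ltW r0) (fundamental_solution_columns ord0 r0 solN)
  (fundamental_solution_columns ord_max r0 solN).
by rewrite N0 det_mx22 !mxE /= mulr1 mulr0 subr0.
Qed.

(** Gronwall's inequality.  As [A] is symmetric with spectral norm at most
    [|p| + |q|], [x ^ 2 + y ^ 2] grows at most at twice that rate. *)
Lemma system_growth a b x y : a <= b -> mu.-integrable `[a, b] (EFin \o p) ->
  mu.-integrable `[a, b] (EFin \o q) -> system_solution p q a b x y ->
  x b ^+ 2 + y b ^+ 2 <=
  expR (2 * \int[mu]_(s in `[a, b]) (`|p s| + `|q s|)) * (x a ^+ 2 + y a ^+ 2).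
Proof.
move=> ab ip iq [X Y].
have iA : mu.-integrable `[a, b] (EFin \o (fun s => `|p s| + `|q s|)).
  exact: integrable_normD.
have A := ac_primitive_integral iA.
have G := ac_primitiveM (ac_primitiveD (ac_primitiveM X X) (ac_primitiveM Y Y))
   (ac_primitive_expR (ac_primitiveZ (-2) A)).
have {G} := ac_primitive_nonincreasing ab G; rewrite /= => H.
have {H} := H _; rewrite set_itv1 Rintegral_set1 mulr0 expR0 mulr1 => H.
have {}H : (x b * x b + y b * y b) *
    expR (-2 * (\int[mu]_(s in `[a, b]) (`|p s| + `|q s|))) <=
    x a * x a + y a * y a.
  apply: H => t _; set e := expR _.
  have e0 : 0 <= e by exact: expR_ge0.
  have : 2 * (- (p t * x t ^+ 2) - 2 * q t * x t * y t + p t * y t ^+ 2 -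
      (`|p t| + `|q t|) * (x t ^+ 2 + y t ^+ 2)) <= 0.
    have h1 : - (p t * x t ^+ 2) <= `|p t| * x t ^+ 2.
      by rewrite -mulNr ler_wpM2r ?sqr_ge0// -normrN ler_norm.
    have h2 : p t * y t ^+ 2 <= `|p t| * y t ^+ 2.
      by rewrite ler_wpM2r ?sqr_ge0// ler_norm.
    have h3 : - (2 * q t * x t * y t) <= `|q t| * (x t ^+ 2 + y t ^+ 2).
      have [q0|/ltW q0] := leP 0 (q t).
        rewrite ger0_norm//; have := mulr_ge0 q0 (sqr_ge0 (x t + y t)); lra.
      rewrite ler0_norm//; have := mulr_le0_ge0 q0 (sqr_ge0 (x t - y t)); lra.
    lra.
  move=> h; have := mulr_ge0_le0 e0 h; lra.
rewrite -ler_pdivrMl ?expR_gt0// -expRN -mulNr !expr2 mulrC.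
by move: H; rewrite mulNr.
Qed.

(** Over one interval a solution moves only as much as the primitives of [p] and
    [q] do, not as much as the integral of [|p| + |q|]: the main term of the
    derivative is removed by an integration by parts. *)
Lemma system_oscillation a b x y (eps K : R) : a <= b ->
  mu.-integrable `[a, b] (EFin \o p) -> mu.-integrable `[a, b] (EFin \o q) ->
  system_solution p q a b x y -> x a ^+ 2 + y a ^+ 2 = 1 ->
  \int[mu]_(s in `[a, b]) (`|p s| + `|q s|) <= K ->
  (forall t, a <= t <= b -> `|\int[mu]_(s in `[a, t]) p s| <= eps) ->
  (forall t, a <= t <= b -> `|\int[mu]_(s in `[a, t]) q s| <= eps) ->
  `|x b - x a| <= eps * (2 * expR K * (1 + K)) /\
  `|y b - y a| <= eps * (2 * expR K * (1 + K)).
Proof.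
move=> ab ip iq sol xy1 AK peps qeps.
have iA : mu.-integrable `[a, b] (EFin \o (fun s => `|p s| + `|q s|)).
  exact: integrable_normD.
have xyK t : a <= t <= b -> `|x t| <= expR K /\ `|y t| <= expR K.
  move=> /andP[at_ tb].
  have := system_growth at_ (integrable_initial tb ip) (integrable_initial tb iq)
    (system_solution_subinterval (lexx a) tb sol).
  rewrite xy1 mulr1 => g.
  have {}g : x t ^+ 2 + y t ^+ 2 <= expR K ^+ 2.
    apply: (le_trans g); rewrite -expRM_natl ler_expR ler_pM2l//.
    apply: le_trans AK; apply: Rintegral_initial_le => //.
    by rewrite at_.
  split; rewrite -ler_sqr ?nnegrE ?expR_ge0// real_normK ?num_real//;
    apply: le_trans g.
  - by rewrite lerDl sqr_ge0.
  - by rewrite lerDr sqr_ge0.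
have [X Y] := sol.
have P := ac_primitive_integral ip; have Q := ac_primitive_integral iq.
have A := ac_primitive_integral iA.
have bab : a <= b <= b by rewrite ab lexx.
have eps0 : 0 <= eps by apply: le_trans (peps b bab).
(* The corrected components x + P x + Q y and y + Q x - P y. *)
have W1 := ac_primitiveD X
  (ac_primitiveD (ac_primitiveM P X) (ac_primitiveM Q Y)).
have W2 := ac_primitiveD Y (ac_primitiveD (ac_primitiveM Q X)
  (ac_primitiveZ (-1) (ac_primitiveM P Y))).
have E := ac_primitiveZ (2 * expR K * eps) A.
have rate t (u v : R) : `|u| <= eps -> `|v| <= eps -> a < t < b ->
    `|u * (- (p t * x t) - q t * y t) + v * (p t * y t - q t * x t)| <=
    2 * expR K * eps * (`|p t| + `|q t|).
  move=> ue ve tab; have [|xK yK] := xyK t; first lra.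
  have lin k l z w : `|z| <= expR K -> `|w| <= expR K ->
      `|k * z + l * w| <= (`|k| + `|l|) * expR K.
    move=> zK wK; rewrite (le_trans (ler_normD _ _))// !normrM mulrDl.
    by rewrite lerD// ler_wpM2l.
  set X' := - (p t * x t) - _; set Y' := p t * y t - _.
  have X'K : `|X'| <= (`|p t| + `|q t|) * expR K.
    rewrite /X' -!mulNr; apply: le_trans (lin _ _ _ _ xK yK) _.
    by rewrite !normrN.
  have Y'K : `|Y'| <= (`|p t| + `|q t|) * expR K.
    rewrite /Y' -!mulNr; apply: le_trans (lin _ _ _ _ yK xK) _.
    by rewrite !normrN.
  rewrite (le_trans (ler_normD _ _))// !normrM.
  have h1 := ler_pM (normr_ge0 _) (normr_ge0 _) ue X'K.
  have h2 := ler_pM (normr_ge0 _) (normr_ge0 _) ve Y'K.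
  lra.
have final (u v d w z : R) : `|u| <= eps -> `|v| <= eps ->
    `|w| <= expR K -> `|z| <= expR K ->
    `|d + (u * w + v * z)| <=
      2 * expR K * eps * \int[mu]_(s in `[a, b]) (`|p s| + `|q s|) ->
    `|d| <= eps * (2 * expR K * (1 + K)).
  by move=> ue ve wK zK; apply: perturbed_increment_le AK ue ve wK zK.
have [xbK ybK] := xyK b bab.
split.
  have := ac_primitive_dist_le ab W1 E.
  rewrite /= !set_itv1 !Rintegral_set1 !mul0r !addr0 mulr0 subr0 => H.
  apply: (final _ _ _ _ _ (peps b bab) (qeps b bab) xbK ybK).
  rewrite addrAC; apply: H => t tab.
  have tab' : a <= t <= b by move: tab => /andP[/ltW -> /ltW ->].
  have := rate t _ _ (peps t tab') (qeps t tab') tab; congr (`|_| <= _); ring.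
have := ac_primitive_dist_le ab W2 E.
rewrite /= !set_itv1 !Rintegral_set1 !mul0r !mulr0 !addr0 subr0 => H.
have peps' t : a <= t <= b -> `|- \int[mu]_(s in `[a, t]) p s| <= eps.
  by rewrite normrN; exact: peps.
apply: (final _ _ _ _ _ (qeps b bab) (peps' b bab) xbK ybK).
rewrite mulNr -mulN1r addrAC; apply: H => t tab.
have tab' : a <= t <= b by move: tab => /andP[/ltW -> /ltW ->].
by have := rate t _ _ (qeps t tab') (peps' t tab') tab; congr (`|_| <= _); ring.
Qed.

(** For [q = 0] the components decouple, and [x exp P] and [y exp (- P)] are
    constant. *)
Lemma system_diagonal a b x y : a <= b -> mu.-integrable `[a, b] (EFin \o p) ->
  system_solution p (fun=> 0) a b x y ->
  x b = x a * expR (- \int[mu]_(s in `[a, b]) p s) /\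
  y b = y a * expR (\int[mu]_(s in `[a, b]) p s).
Proof.
move=> ab ip [X Y]; have P := ac_primitive_integral ip.
have := ac_primitive_constant ab (ac_primitiveM X (ac_primitive_expR P)).
have := ac_primitive_constant ab
  (ac_primitiveM Y (ac_primitive_expR (ac_primitiveZ (-1) P))).
rewrite /= !set_itv1 !Rintegral_set1 mulr0 expR0 !mulr1 !mulN1r => cy cx.
split.
  by rewrite -cx; [rewrite -mulrA -expRD subrr expR0 mulr1|move=> t _; ring].
by rewrite -cy; [rewrite -mulrA -expRD addNr expR0 mulr1|move=> t _; ring].
Qed.
(** [M t = N t * (N r)^-1]: since [H_N = (N r)^T H_M (N r)] and [det (N r) = 1],
    the determinant of the integral does not see the past of [r]. *)
Lemma transition_matrix (N : R -> 'M[R]_2) r : 0 <= r ->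
  is_fundamental_solution (Qmx p q) N ->
  exists M : R -> 'M[R]_2, [/\ M r = 1%:M,
    forall j, system_solution p q r (r + 2)
      (fun t => M t ord0 j) (fun t => M t ord_max j),
    forall i j, mu.-integrable `[r, r + 2] (EFin \o (fun t => Hmx M t i j)) &
    EQ N r = \det (mx_integral `[r, r + 2] (Hmx M)) - 4].
Proof.
move=> r0 solN; pose M t := N t *m \adj (N r).
have detN := fundamental_solution_det r0 solN.
have col j : system_solution p q r (r + 2)
    (fun t => M t ord0 j) (fun t => M t ord_max j).
  have r2 : 0 < r + 2 by lra.
  have := system_solution_linear ((\adj (N r)) ord0 j) ((\adj (N r)) ord_max j)
    (fundamental_solution_columns ord0 r2 solN)
    (fundamental_solution_columns ord_max r2 solN).
  move=> /(system_solution_subinterval r0 (lexx _)).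
  have ME i : (fun t => M t i j) = (fun t => (\adj (N r)) ord0 j * N t i ord0 +
      (\adj (N r)) ord_max j * N t i ord_max).
    apply/funext => t; rewrite mxE !big_ord_recl big_ord0 lift0_max addr0.
    by rewrite mulrC [X in _ + X]mulrC.
  by rewrite !ME.
have iM i j : mu.-integrable `[r, r + 2] (EFin \o (fun t => Hmx M t i j)).
  have [Xi Yi] := col i; have [Xj Yj] := col j.
  have := ac_primitive_integrable
    (ac_primitiveD (ac_primitiveM Xi Xj) (ac_primitiveM Yi Yj)).
  congr (_.-integrable _ (_ \o _)); apply/funext => t.
  by rewrite HmxE.
exists M; split => //; first by rewrite /M mul_mx_adj detN.
rewrite /EQ; congr (_ - _).
have -> : Hmx N = fun t => (N r)^T *m Hmx M t *m N r.
  apply/funext => t; rewrite /Hmx.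
  have -> : N t = M t *m N r by rewrite /M -mulmxA mul_adj_mx detN mulmx1.
  by rewrite trmx_mul !mulmxA.
by rewrite mx_integral_congruence// !det_mulmx det_tr detN mul1r mulr1.
Qed.

End system.

(** * Bounds on [EQ] at a fixed time *)

(** Here [c] is the constant of the distance from [M] to the identity and [d] that
    of the distance from the integral of [H_M] to [2]; [B] is a bound for [eps],
    used to absorb squares. *)
Definition EQ_const (R : realType) (B K : R) : R :=
  let c := 2 * expR K * (1 + K) in
  let d := 4 * c + 4 * c ^+ 2 * B in
  4 * d + 2 * d ^+ 2 * B.

Section EQ_bounds.
Variables (R : realType) (p q : R -> R) (N : R -> 'M[R]_2) (r : R).
Local Notation mu := (@lebesgue_measure R).
Hypotheses (r0 : 0 <= r) (ip : mu.-integrable `[r, r + 2] (EFin \o p)).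

(** The determinant is the product of [int exp (-2 P)] and [int exp (2 P)]; the
    errors of first order in [P] cancel between the two factors. *)
Lemma EQ_bound_diagonal (eps B : R) : eps <= B ->
  is_fundamental_solution (Qmx p (fun=> 0)) N ->
  (forall t, r <= t <= r + 2 -> `|\int[mu]_(s in `[r, t]) p s| <= eps) ->
  `|EQ N r| <= eps ^+ 2 * (16 * expR (2 * B) ^+ 3 + 16 * expR (2 * B) ^+ 2).
Proof.
move=> epsB solN peps; set L := expR (2 * B).
have [M [Mr Mcol iH ->]] := transition_matrix r0 solN.
have eps0 : 0 <= eps by apply: le_trans (peps r _); rewrite ?lexx//; lra.
have L0 : 0 <= L by exact: expR_ge0.
pose P t := \int[mu]_(s in `[r, t]) p s.
have MP t : r <= t <= r + 2 ->
    [/\ M t ord0 ord0 = expR (- P t), M t ord_max ord0 = 0,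
        M t ord0 ord_max = 0 & M t ord_max ord_max = expR (P t)].
  move=> /andP[rt tr].
  have sol j := system_solution_subinterval (lexx r) tr (Mcol j).
  have [a0 b0] := system_diagonal rt (integrable_initial tr ip) (sol ord0).
  have [a1 b1] := system_diagonal rt (integrable_initial tr ip) (sol ord_max).
  by rewrite a0 b0 a1 b1 Mr !mxE /= !mul1r !mul0r.
have HP t : r <= t <= r + 2 ->
    [/\ Hmx M t ord0 ord0 = expR (- (2 * P t)), Hmx M t ord_max ord0 = 0,
        Hmx M t ord0 ord_max = 0 & Hmx M t ord_max ord_max = expR (2 * P t)].
  move=> /MP [m0 m1 m2 m3]; rewrite !HmxE m0 m1 m2 m3 -!expRD.
  by split; rewrite ?mulr0 ?mul0r ?addr0 ?add0r//; congr expR; ring.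
have exp_near s : `|s| <= 2 * eps -> `|expR s - 1| <= L * (2 * eps).
  move=> se; have sB : s <= 2 * B by apply: (le_trans (ler_norm _)); lra.
  have B0 : 0 <= 2 * B by lra.
  have := expR_lipschitz sB B0; rewrite expR0 subr0 => /le_trans; apply.
  by rewrite ler_wpM2l.
have P2 t : r <= t <= r + 2 -> `|2 * P t| <= 2 * eps.
  by move=> /peps h; rewrite normrM ger0_norm// ler_wpM2l.
have I01 : \int[mu]_(t in `[r, r + 2]) Hmx M t ord0 ord_max = 0.
  apply/eqP; rewrite -normr_le0.
  have := Rintegral_itv2_near (c := 0) (z := 0) (iH ord0 ord_max).
  by rewrite mulr0 subr0; apply => t /HP[_ _ -> _]; rewrite subr0 normr0.
have h0 : `|\int[mu]_(t in `[r, r + 2]) Hmx M t ord0 ord0 - 2 * 1| <=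
    2 * (L * (2 * eps)).
  apply: Rintegral_itv2_near => // t /[dup] /HP[-> _ _ _] /P2 tP.
  by apply: exp_near; rewrite normrN.
have h1 : `|\int[mu]_(t in `[r, r + 2]) Hmx M t ord_max ord_max - 2 * 1| <=
    2 * (L * (2 * eps)).
  apply: Rintegral_itv2_near => // t /[dup] /HP[_ _ _ ->] /P2.
  exact: exp_near.
have [iD IntD] := Rintegral_itv_lincomb 1 1 (iH ord0 ord0) (iH ord_max ord_max).
(* exp s + exp (- s) - 2 has no term of first order in s. *)
have h2 : `|\int[mu]_(t in `[r, r + 2])
    (1 * Hmx M t ord0 ord0 + 1 * Hmx M t ord_max ord_max) - 2 * 2| <=
    2 * (L * (L * (2 * eps)) ^+ 2).
  apply: Rintegral_itv2_near => // t /[dup] /HP[-> _ _ ->] /P2 tP.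
  rewrite !mul1r.
  set s := 2 * P t in tP *.
  have -> : expR (- s) + expR s - 2 = expR (- s) * (expR s - 1) ^+ 2.
    have uw : expR (- s) * expR s = 1 by rewrite -expRD addNr expR0.
    transitivity ((expR (- s) * expR s) * expR s -
      2 * (expR (- s) * expR s) + expR (- s)).
      by rewrite uw; ring.
    by ring.
  rewrite normrM normrX ger0_norm ?expR_ge0// ler_pM ?expR_ge0 ?sqr_ge0//.
    rewrite ler_expR (le_trans (ler_norm _))// normrN; lra.
  by rewrite ler_sqr ?nnegrE// ?exp_near// mulr_ge0// mulr_ge0.
rewrite IntD !mul1r in h2.
rewrite det_mx22 !mxE I01 mul0r subr0.
move: h0 h1 h2; rewrite mulr1.
set a := Rintegral _ _ _; set b := Rintegral _ _ _; move: a b => a b h0 h1 h2.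
have h3 := ler_pM (normr_ge0 _) (normr_ge0 _) h0 h1.
have -> : a * b - 4 = 2 * (a + b - 2 * 2) + (a - 2) * (b - 2) by ring.
rewrite (le_trans (ler_normD _ _))// !normrM ger0_norm//.
apply: (@le_trans _ _ (2 * (2 * (L * (L * (2 * eps)) ^+ 2)) +
    2 * (L * (2 * eps)) * (2 * (L * (2 * eps))))).
  by rewrite lerD// ler_wpM2l.
rewrite le_eqVlt; apply/orP; left; apply/eqP; ring.
Qed.

Lemma EQ_bound_general (eps B K : R) : eps <= B ->
  mu.-integrable `[r, r + 2] (EFin \o q) ->
  is_fundamental_solution (Qmx p q) N ->
  \int[mu]_(s in `[r, r + 2]) (`|p s| + `|q s|) <= K ->
  (forall t, r <= t <= r + 2 -> `|\int[mu]_(s in `[r, t]) p s| <= eps) ->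
  (forall t, r <= t <= r + 2 -> `|\int[mu]_(s in `[r, t]) q s| <= eps) ->
  `|EQ N r| <= eps * EQ_const B K.
Proof.
move=> epsB iq solN AK peps qeps; rewrite /EQ_const.
set c := 2 * expR K * _; set d := 4 * c + _.
have [M [Mr Mcol iH ->]] := transition_matrix r0 solN.
have eps0 : 0 <= eps by apply: le_trans (peps r _); rewrite ?lexx//; lra.
have K0 : 0 <= K.
  by apply: le_trans AK; apply: Rintegral_ge0 => s _; rewrite addr_ge0.
have c0 : 0 <= c by rewrite !mulr_ge0 ?expR_ge0 ?addr_ge0.
have iA := integrable_normD ip iq.
have M1 t : r <= t <= r + 2 -> forall i j, `|M t i j - (i == j)%:R| <= eps * c.
  move=> /andP[rt tr] i j.
  have AKt : \int[mu]_(s in `[r, t]) (`|p s| + `|q s|) <= K.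
    apply: le_trans AK; apply: Rintegral_initial_le => //.
    by rewrite rt.
  have sol := system_solution_subinterval (lexx r) tr (Mcol j).
  have in2 s : r <= s <= t -> r <= s <= r + 2.
    by move=> /andP[-> st]; exact: le_trans tr.
  have [] := system_oscillation rt
    (integrable_initial tr ip) (integrable_initial tr iq) sol _ AKt
    (fun s st => peps s (in2 s st)) (fun s st => qeps s (in2 s st)).
    rewrite Mr !mxE; move: j {sol}; apply: ord2P;
    by rewrite /= expr1n expr0n ?addr0 ?add0r.
  by rewrite Mr !mxE; move: i; apply: ord2P.
have H1 i j : `|(mx_integral `[r, r + 2] (Hmx M)) i j - 2 * (i == j)%:R| <=
    2 * (2 * (eps * c) + 2 * (eps * c) ^+ 2).
  by rewrite mxE; apply: Rintegral_itv2_near => // t /M1 Mt; exact: Hmx_near_1.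
apply: (le_trans (det_near_scalar2 H1)).
set z := 2 * (_ + _).
have zd : z <= eps * d.
  have : c ^+ 2 * eps * eps <= c ^+ 2 * eps * B.
    by rewrite ler_wpM2l// mulr_ge0// sqr_ge0.
  by rewrite /z /d; lra.
have z0 : 0 <= z.
  by rewrite mulr_ge0// addr_ge0// mulr_ge0// ?sqr_ge0// mulr_ge0.
have zz : z ^+ 2 <= (eps * d) ^+ 2 by rewrite ler_sqr ?nnegrE// (le_trans z0).
have : d ^+ 2 * eps * eps <= d ^+ 2 * eps * B.
  by rewrite ler_wpM2l// mulr_ge0// sqr_ge0.
lra.
Qed.

End EQ_bounds.

(** * Decay as the time tends to infinity *)

Section asymptotics.
Variable R : realType.
Local Notation mu := (@lebesgue_measure R).
Implicit Types (f g p q : R -> R).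

Lemma L1loc_integrable f a b : L1loc f -> 0 <= a -> a < b ->
  mu.-integrable `[a, b] (EFin \o f).
Proof.
move=> f1 a0 ab; apply: integrableS (f1 b _); last exact: le_lt_trans ab.
- exact: measurable_itv.
- exact: measurable_itv.
- by move=> s /=; rewrite !in_itv /= => /andP[as_ ->]; rewrite (le_trans a0).
Qed.

Lemma tail_sup_bound f g : (forall r, 0 < g r) ->
  ereal_bigO_pinfty (tail_sup f) g ->
  exists2 C, 0 <= C & \forall r \near +oo, forall t, r <= t ->
    `|\int[mu]_(s in `[r, t]) f s| <= C * g r.
Proof.
move=> g0 [C fC]; exists `|C| => //; move: fC; apply: filterS => r fC t rt.
rewrite -lee_fin (le_trans (ereal_sup_ubound _ : (_ <= tail_sup f r)%E))//.
  by exists t.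
rewrite (le_trans (lee_abs _))// (le_trans fC)// lee_fin (gtr0_norm (g0 r)).
by rewrite ler_pM2r// ler_norm.
Qed.

Lemma unif_loc_L1_bound p q : L1loc p -> L1loc q -> unif_loc_L1 p q ->
  exists K, forall r, 0 <= r ->
    \int[mu]_(s in `[r, r + 2]) (`|p s| + `|q s|) <= K.
Proof.
move=> p1 q1; rewrite /unif_loc_L1; set S := [set _ | _ in _] => Sfin.
pose h s := `|p s| + `|q s|.
have h_int a b : 0 <= a -> a < b -> mu.-integrable `[a, b] (EFin \o h).
  by move=> a0 ab; apply: integrable_normD; exact: L1loc_integrable.
have hS r : 0 <= r ->
    (\int[mu]_(s in `[r, (r + 1)%R]) (h s)%:E <= ereal_sup S)%E.
  by move=> r0; apply: ereal_sup_ubound; exists r.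
have S0 : (0 <= ereal_sup S)%E.
  apply: le_trans (hS 0 _) => //.
  by apply: integral_ge0 => s _; rewrite lee_fin addr_ge0.
have Sf : ereal_sup S \is a fin_num by rewrite ge0_fin_numE.
have hK r : 0 <= r -> \int[mu]_(s in `[r, r + 1]) h s <= fine (ereal_sup S).
  move=> r0; apply: fine_le => //; last exact: hS.
  apply: integrable_fin_num; first exact: measurable_itv.
  by apply: h_int; rewrite ?ltrDl.
exists (fine (ereal_sup S) + fine (ereal_sup S)) => r r0.
have i2 : mu.-integrable `[r, r + 2] (EFin \o h).
  by apply: h_int; rewrite ?ltrDl.
have i1 : mu.-integrable `]r + 1, r + 2] (EFin \o h).
  apply: integrableS i2; [exact: measurable_itv|exact: measurable_itv|].
  by move=> s /=; rewrite !in_itv /= => /andP[h1 h2]; lra.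
have split2 :
    \int[mu]_(s in `[r, r + 2]) h s - \int[mu]_(s in `[r, r + 1]) h s =
    \int[mu]_(s in `]r + 1, r + 2]) h s.
  by apply: Rintegral_itvB; rewrite // bnd_simp; lra.
have := hK (r + 1); rewrite (_ : r + 1 + 1 = r + 2); last by ring.
rewrite -Rintegral_itv_obnd_cbnd// -split2 lerBlDl => H.
by rewrite (le_trans (H _)) ?lerD2r ?hK// addr_ge0.
Qed.

Lemma bigO_pinfty_bound f g (C : R) : (forall r, 0 <= g r) ->
  (\forall r \near +oo, `|f r| <= C * g r) -> f =O_ +oo g.
Proof.
move=> g0 fC; apply/eqOP; near=> k; move: fC.
apply: filterS => r /le_trans; apply.
by rewrite (ger0_norm (g0 r)) ler_wpM2r.
Unshelve. all: by end_near.
Qed.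

Lemma expR_decay_le1 (delta r : R) : 0 <= delta -> 0 <= r ->
  expR (- (delta * r)) <= 1.
Proof. by move=> d0 r0; rewrite -expR0 ler_expR oppr_le0 mulr_ge0. Qed.

End asymptotics.

Theorem theorem5 (R : realType) (delta : R) (p q : R -> R)
    (delta_gt0 : 0 < delta) (p_L1loc : L1loc p) (q_L1loc : L1loc q) :
  (ereal_bigO_pinfty (tail_sup p) (fun r => expR (- (delta * r / 2))) ->
   forall N : R -> 'M[R]_2,
     is_fundamental_solution (Qmx p (fun=> 0)) N ->
     EQ N =O_ +oo (fun r : R => expR (- (delta * r)))) /\
  (unif_loc_L1 p q ->
   ereal_bigO_pinfty (tail_sup p) (fun r => expR (- (delta * r))) ->
   ereal_bigO_pinfty (tail_sup q) (fun r => expR (- (delta * r))) ->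
   forall N : R -> 'M[R]_2,
     is_fundamental_solution (Qmx p q) N ->
     EQ N =O_ +oo (fun r : R => expR (- (delta * r)))).
Proof.
split=> [tailp N solN|unifpq tailp tailq N solN].
  have [C C0 pC] := tail_sup_bound (fun r => expR_gt0 _) tailp.
  apply: (@bigO_pinfty_bound _ _ _
      (C ^+ 2 * (16 * expR (2 * C) ^+ 3 + 16 * expR (2 * C) ^+ 2))).
    by move=> r; exact: expR_ge0.
  near=> r; have r0 : 0 <= r by near: r; exact: nbhs_pinfty_ge.
  have pCr : forall t, r <= t ->
      `|\int[@lebesgue_measure R]_(s in `[r, t]) p s| <=
      C * expR (- (delta * r / 2)) by near: r.
  have epsB : C * expR (- (delta * r / 2)) <= C.
    by rewrite ler_piMr// mulrAC expR_decay_le1// divr_ge0// ltW.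
  apply: (le_trans (EQ_bound_diagonal r0 _ epsB solN _)) => //.
  - by apply: L1loc_integrable; rewrite ?ltrDl.
  - by move=> t /andP[rt _]; exact: pCr.
  rewrite exprMn -(expRM_natl 2 (- _)) mulrN (mulrC 2) divfK//.
  by rewrite -!mulrA (mulrC (expR _)).
have [K pqK] := unif_loc_L1_bound p_L1loc q_L1loc unifpq.
have [C C0 pC] := tail_sup_bound (fun r => expR_gt0 _) tailp.
have [D D0 qD] := tail_sup_bound (fun r => expR_gt0 _) tailq.
apply: (@bigO_pinfty_bound _ _ _ ((C + D) * EQ_const (C + D) K)).
  by move=> r; exact: expR_ge0.
near=> r; have r0 : 0 <= r by near: r; exact: nbhs_pinfty_ge.
have pCr : forall t, r <= t ->
    `|\int[@lebesgue_measure R]_(s in `[r, t]) p s| <=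
    C * expR (- (delta * r)) by near: r.
have qDr : forall t, r <= t ->
    `|\int[@lebesgue_measure R]_(s in `[r, t]) q s| <=
    D * expR (- (delta * r)) by near: r.
have epsB : (C + D) * expR (- (delta * r)) <= C + D.
  by rewrite ler_piMr ?addr_ge0// expR_decay_le1// ltW.
rewrite mulrAC; apply: (EQ_bound_general r0 _ epsB _ solN (pqK r r0)).
- by apply: L1loc_integrable; rewrite ?ltrDl.
- by apply: L1loc_integrable; rewrite ?ltrDl.
- move=> t /andP[rt _]; apply: (le_trans (pCr t rt)).
  by rewrite ler_wpM2r ?expR_ge0// lerDl.
- move=> t /andP[rt _]; apply: (le_trans (qDr t rt)).
  by rewrite ler_wpM2r ?expR_ge0// lerDr.
Unshelve. all: by end_near.
Qed.
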